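(* Let $(\Omega,\mathcal F,(\mathcal F_t)_{t\in\mathbb N_0})$ be a discrete-time filtered measurable space, let $V=(V_t)_{t\ge0}$ be a nonnegative, adapted, pathwise nondecreasing process, and let $H$ be a null hypothesis (a set of probability measures on $(\Omega,\mathcal F)$). The following are equivalent: (i) $V$ is an $H$-$e$-process; (ii) $\mathbb E_P[V_t]\le1$ for every deterministic $t$ and every $P\in H$; (iii) with $V_\infty:=\sup_{t\ge0}V_t$, one has $\mathbb E_P[V_\infty]\le1$ for every $P\in H$.
   Context: A nonnegative $(\mathcal F_t)$-adapted process $E=(E_t)_{t\ge0}$ is an $e$-process for $H$ (an $H$-$e$-process) if $\mathbb E_P[E_\tau]\le1$ for every $P\in H$ and every $(\mathcal F_t)$-stopping time $\tau$ with $P(\tau<\infty)=1$. (The initial value need not equal one.) *)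

(* Defs.v *)
From mathcomp Require Export all_boot all_order all_algebra.
From mathcomp Require Export all_classical all_reals all_analysis.
From mathcomp Require Export measurable_realfun.
Set Implicit Arguments.
Unset Strict Implicit.
Unset Printing Implicit Defensive.
Import Order.TTheory GRing.Theory Num.Theory.
Local Open Scope classical_set_scope.
Local Open Scope ereal_scope.

Definition filtration d (T : measurableType d) (F : nat -> set_system T) :=
  [/\ forall t, sigma_algebra setT (F t),
      forall t, F t `<=` @measurable d T &
      forall s t, (s <= t)%N -> F s `<=` F t].

(* Processes take values in [-oo, +oo], so a nonnegative process may take the
   value +oo; a finite-valued process is one of the form [fun t w => (X t w)%:E]. *)
Definition nonnegative_process (T : Type) (R : realType)
    (E : nat -> T -> \bar R) := forall t w, 0 <= E t w.

Definition adapted (T : Type) (R : realType) (F : nat -> set_system T)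
    (E : nat -> T -> \bar R) :=
  forall t (B : set (\bar R)), measurable B -> F t (E t @^-1` B).

(* Random times are valued in nat extended by infinity, encoded as [None]. *)
Definition stopping_time (T : Type) (F : nat -> set_system T)
    (tau : T -> option nat) :=
  forall t, F t [set w | exists2 n, tau w = Some n & (n <= t)%N].

(* The value 0 on {tau = infinity} is a convention; [is_eprocess] only uses
   times with P(tau < infinity) = 1, for which it does not matter. *)
Definition stopped (T : Type) (R : realType) (E : nat -> T -> \bar R)
    (tau : T -> option nat) (w : T) : \bar R :=
  if tau w is Some n then E n w else 0.

Definition is_eprocess d (T : measurableType d) (R : realType)
    (F : nat -> set_system T) (H : set (probability T R))
    (E : nat -> T -> \bar R) :=
  [/\ nonnegative_process E, adapted F E &
      forall (P : probability T R) (tau : T -> option nat),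
        H P -> stopping_time F tau -> P [set w | isSome (tau w)] = 1 ->
        \int[P]_w stopped E tau w <= 1].

(* Main.v *)
Require Import Defs.
Set Implicit Arguments.
Unset Strict Implicit.
Unset Printing Implicit Defensive.
Import Order.TTheory GRing.Theory Num.Theory.
Local Open Scope classical_set_scope.
Local Open Scope ereal_scope.

(** The three conditions are proved in a cycle.  A deterministic time is a
    stopping time, so an e-process has mean at most one at each [t].  The
    variables [V t] increase pointwise to their supremum, so by monotone
    convergence the bound on the means passes to the supremum.  Finally, on
    the event that a stopping time [tau] is finite the stopped value is one of
    the [V n], hence at most the supremum; elsewhere it is [0], which is at
    most the supremum because [V] is nonnegative.  Thus the bound on the mean
    of the supremum covers every stopping time at once.  The only analytic
    care concerns measurability: monotonicity of the integral is applied to the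
    stopped variable, which is measurable because it is glued from the [V n]
    along the countable partition of the space into level sets of [tau]. *)

Lemma adapted_measurable d (T : measurableType d) (R : realType)
    (F : nat -> set_system T) (V : nat -> T -> \bar R) :
  filtration F -> adapted F V -> forall t, measurable_fun setT (V t).
Proof.
move=> [_ Fm _] adV t _ B mB; rewrite setTI; exact/(Fm t)/adV.
Qed.

Lemma stopping_time_cst d (T : measurableType d) (F : nat -> set_system T) t :
  filtration F -> stopping_time F (fun=> Some t).
Proof.
move=> [sF _ _] s; have [F0 FC _] := sF s.
have [ts|st] := leqP t s.
- rewrite (_ : [set _ | _] = setT `\` set0); first exact: FC.
  by rewrite setD0 -subTset => w _; exists t.
- rewrite (_ : [set _ | _] = set0) // -subset0 => w [n [<-]].
  by rewrite leqNgt st.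
Qed.

(** The stopping-time axiom controls the events that [tau] is at most [n];
    each level set is the difference of two consecutive ones. *)
Lemma stopping_time_level_measurable d (T : measurableType d)
    (F : nat -> set_system T) (tau : T -> option nat) :
  filtration F -> stopping_time F tau ->
  forall n, measurable [set w | tau w = Some n].
Proof.
move=> [_ Fm _] st n.
have mle t := Fm t _ (st t).
case: n => [|n].
- rewrite (_ : [set _ | _] = [set w | exists2 m, tau w = Some m & (m <= 0)%N]).
    exact: mle.
  apply/seteqP; split=> [w /= ->|w /= [m ->]]; first by exists 0%N.
  by rewrite leqn0 => /eqP ->.
- rewrite (_ : [set _ | _] =
      [set w | exists2 m, tau w = Some m & (m <= n.+1)%N] `\`
      [set w | exists2 m, tau w = Some m & (m <= n)%N]).
    by apply: measurableD; exact: mle.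
  apply/seteqP; split=> [w /= twn|w /= [[m twm mn1] nle]].
  + split; first by exists n.+1.
    by rewrite twn => -[m [<-]]; rewrite ltnn.
  + rewrite twm; congr Some; apply/eqP; rewrite eqn_leq mn1 /= ltnNge.
    by apply/negP => mn; apply: nle; exists m.
Qed.

Lemma measurable_stopped d (T : measurableType d) (R : realType)
    (F : nat -> set_system T) (V : nat -> T -> \bar R)
    (tau : T -> option nat) :
  filtration F -> adapted F V -> stopping_time F tau ->
  measurable_fun setT (stopped V tau).
Proof.
move=> filF adV st.
have mlev := stopping_time_level_measurable filF st.
have mfin : measurable (\bigcup_n [set w | tau w = Some n]).
  exact: bigcup_measurable.
rewrite -(setvU (\bigcup_n [set w | tau w = Some n])).
apply/measurable_funU => //; first exact: measurableC.
split.
- apply: (eq_measurable_fun (cst 0)) => [w|]; last exact: measurable_cst.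
  rewrite inE /stopped => ninf; case tw: (tau w) => [n|] //.
  by case: ninf; exists n.
- apply/measurable_fun_bigcup => // n.
  apply: (eq_measurable_fun (V n)) => [w|].
    by rewrite inE /stopped /= => ->.
  exact/measurable_funTS/(adapted_measurable filF adV).
Qed.

Lemma nondecreasing_process_limn (T : Type) (R : realType)
    (V : nat -> T -> \bar R) :
  (forall w s t, (s <= t)%N -> V s w <= V t w) ->
  forall w, limn (V^~ w) = ereal_sup [set V t w | t in [set: nat]].
Proof.
move=> ndV w; apply/cvg_lim => //.
by apply: ereal_nondecreasing_cvgn => s t; exact: ndV.
Qed.

Lemma stopped_le_sup (T : Type) (R : realType) (V : nat -> T -> \bar R)
    (tau : T -> option nat) :
  nonnegative_process V ->
  forall w, stopped V tau w <= ereal_sup [set V t w | t in [set: nat]].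
Proof.
move=> V0 w; rewrite /stopped; case: (tau w) => [n|].
- by apply: ereal_sup_ubound; exists n.
- by apply: (le_trans (V0 0%N w)); apply: ereal_sup_ubound; exists 0%N.
Qed.

Theorem proposition2p9 (R : realType) (d : measure_display)
    (T : measurableType d) (F : nat -> set_system T)
    (H : set (probability T R)) (V : nat -> T -> \bar R)
    (filF : filtration F)
    (V_ge0 : nonnegative_process V)
    (V_adapted : adapted F V)
    (V_nd : forall w s t, (s <= t)%N -> V s w <= V t w) :
  [<-> is_eprocess F H V;
       forall (t : nat) (P : probability T R), H P -> \int[P]_w V t w <= 1;
       forall P : probability T R, H P ->
         \int[P]_w ereal_sup [set V t w | t in [set: nat]] <= 1 ].
Proof.
have mV := adapted_measurable filF V_adapted.
have limV := nondecreasing_process_limn V_nd.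
tfae.
- move=> [_ _ eV] t P HP; apply: (eV P (fun=> Some t) HP).
    exact: stopping_time_cst.
  rewrite (_ : [set _ | _] = setT) ?probability_setT //.
  by rewrite -subTset.
- move=> V1 P HP; under eq_integral do rewrite -limV.
  rewrite monotone_convergence //; last by move=> w _ s t; exact: V_nd.
  apply: lime_le; last by apply: nearW => t; exact: V1.
  apply: ereal_nondecreasing_is_cvgn => s t st.
  by apply: ge0_le_integral => // w _; exact: V_nd.
- move=> V1; split=> // P tau HP st _.
  apply: le_trans (V1 P HP); apply: ge0_le_integral => //.
  + by move=> w _; rewrite /stopped; case: (tau w).
  + exact: (measurable_stopped filF V_adapted st).
  + apply: (emeasurable_fun_cvg V) => // w _; rewrite -limV.
    by apply: ereal_nondecreasing_is_cvgn => s t; exact: V_nd.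
  + by move=> w _; exact: stopped_le_sup.
Qed.
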